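(* Let $A = L^1[0, 1]$ be the Volterra algebra. Let $f \in A$ be such that $f \geq 0$ and $0, 1 \notin \mathrm{supp} f$. Then $V_A(f) = \|f\|_1 \mathbb{D}$. In particular, $V_A(f)$ is convex.
   Context: $\mathbb{D} = \{z \in \mathbb{C} : |z| \leq 1\}$ is the closed unit disc. The Volterra algebra is the Banach algebra $L^1[0,1]$ of (classes of) functions $f : [0,1] \to \mathbb{C}$ with $\|f\|_1 = \int_0^1 |f(t)|\,dt < \infty$, with the product $(f \star g)(s) = \int_0^s f(s-t)g(t)\,dt$. $\mathrm{supp} f$ is the (closed, essential) support of $f$, and $f \ge 0$ is understood almost everywhere. For a complex normed algebra $(A,\|\cdot\|)$ with dual $A^*$, let $S(A) = \{x \in A : \|x\| = 1\}$, and for $x \in S(A)$ let $D_A(x) = \{\varphi \in A^* : \|\varphi\| = 1 = \varphi(x)\}$. For $a \in A$ and $x \in S(A)$ let $V_A(a;x) = \{\varphi(ax) : \varphi \in D_A(x)\}$ (where $ax$ is the product in $A$). The spatial numerical range of $a$ is $V_A(a) = \bigcup\{V_A(a;x) : x \in S(A)\} \subseteq \mathbb{C}$. *)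

(* Defs.v *)
From HB Require Import structures.
From mathcomp Require Import all_boot all_order all_algebra complex.
From mathcomp Require Import all_classical all_reals all_analysis.
From mathcomp Require Import measurable_realfun lra.

Set Implicit Arguments.
Unset Strict Implicit.
Unset Printing Implicit Defensive.

Import Order.TTheory GRing.Theory Num.Theory.
Import numFieldNormedType.Exports.

Local Open Scope classical_set_scope.
Local Open Scope complex_scope.
Local Open Scope ring_scope.

Local Notation cRe := (@complex.Re _).
Local Notation cIm := (@complex.Im _).
Local Notation normc := (@Normc.normc _).

Section complex_integral.
Context d (T : measurableType d) (R : realType).
Variable mu : {measure set T -> \bar R}.
Implicit Types (D : set T) (f g : T -> R[i]).

(* [R[i]] carries no sigma-algebra in the library: measurability and integration
   are componentwise, [normc z : R] being the modulus (and [`|z| = (normc z)%:C]). *)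
Definition cmeasurable_fun D f :=
  measurable_fun D (cRe \o f) /\ measurable_fun D (cIm \o f).

Definition cintegrable D f :=
  cmeasurable_fun D f /\ (\int[mu]_(x in D) (normc (f x))%:E < +oo)%E.

Definition cintegral D f : R[i] :=
  (\int[mu]_(x in D) cRe (f x)) +i* (\int[mu]_(x in D) cIm (f x)).

End complex_integral.

Section complex_lemmas.
Variable R : realType.
Implicit Types z w : R[i].

Lemma ReD z w : cRe (z + w) = cRe z + cRe w. Proof. by case: z w => ? ? []. Qed.
Lemma ImD z w : cIm (z + w) = cIm z + cIm w. Proof. by case: z w => ? ? []. Qed.
Lemma ReM z w : cRe (z * w) = cRe z * cRe w - cIm z * cIm w.
Proof. by case: z w => ? ? []. Qed.
Lemma ImM z w : cIm (z * w) = cRe z * cIm w + cIm z * cRe w.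
Proof. by case: z w => ? ? []. Qed.

Lemma normc_ge0 z : 0 <= normc z.
Proof. by case: z => a b; rewrite sqrtr_ge0. Qed.

Lemma normcE z : normc z = Num.sqrt (cRe z ^+ 2 + cIm z ^+ 2).
Proof. by case: z. Qed.

Lemma ler_Re_normc z : `|cRe z| <= normc z.
Proof.
by rewrite normcE -sqrtr_sqr ler_wsqrtr// lerDl sqr_ge0.
Qed.

Lemma ler_Im_normc z : `|cIm z| <= normc z.
Proof.
by rewrite normcE -sqrtr_sqr ler_wsqrtr// lerDr sqr_ge0.
Qed.

Lemma normc_le_ReIm z : normc z <= `|cRe z| + `|cIm z|.
Proof.
rewrite normcE -[leRHS]ger0_norm ?addr_ge0// -sqrtr_sqr ler_wsqrtr//.
rewrite sqrrD !real_normK ?num_real// addrAC lerDl.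
by rewrite mulrn_wge0// mulr_ge0.
Qed.

Lemma normcD z w : normc (z + w) <= normc z + normc w.
Proof. exact: (le_normcD (z : Rcomplex R) w). Qed.

Lemma normC_normc z : `|z| = (normc z)%:C. Proof. by case: z. Qed.

End complex_lemmas.

Section complex_integral_theory.
Context d (T : measurableType d) (R : realType).
Variable mu : {measure set T -> \bar R}.
Implicit Types (D : set T) (f g : T -> R[i]).

Lemma measurable_normc D f :
  cmeasurable_fun D f -> measurable_fun D (normc \o f).
Proof.
move=> [mr mi].
rewrite (_ : normc \o f =
  Num.sqrt \o (fun x => (cRe (f x)) ^+ 2 + (cIm (f x)) ^+ 2)); last first.
  by apply/funext => x /=; rewrite normcE.
apply: measurableT_comp => //.
  exact: (continuous_measurable_fun (@sqrt_continuous R)).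
by apply: measurable_funD; apply: measurable_funX.
Qed.

Lemma measurable_EFin_normc D f :
  cmeasurable_fun D f -> measurable_fun D (fun x => (normc (f x))%:E).
Proof. by move=> mf; apply/measurable_EFinP; exact: measurable_normc. Qed.

Lemma cmeasurable_funD D f g : cmeasurable_fun D f -> cmeasurable_fun D g ->
  cmeasurable_fun D (fun x => f x + g x).
Proof.
move=> [fr fi] [gr gi]; split.
  rewrite (_ : _ \o _ = (cRe \o f) \+ (cRe \o g)); last first.
    by apply/funext => x /=; rewrite ReD.
  exact: measurable_funD.
rewrite (_ : _ \o _ = (cIm \o f) \+ (cIm \o g)); last first.
  by apply/funext => x /=; rewrite ImD.
exact: measurable_funD.
Qed.

Lemma cmeasurable_funM D f g : cmeasurable_fun D f -> cmeasurable_fun D g ->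
  cmeasurable_fun D (fun x => f x * g x).
Proof.
move=> [fr fi] [gr gi]; split.
  rewrite (_ : _ \o _ = (cRe \o f) \* (cRe \o g) \- (cIm \o f) \* (cIm \o g)).
    by apply: measurable_funB; exact: measurable_funM.
  by apply/funext => x /=; rewrite ReM.
rewrite (_ : _ \o _ = (cRe \o f) \* (cIm \o g) \+ (cIm \o f) \* (cRe \o g)).
  by apply: measurable_funD; exact: measurable_funM.
by apply/funext => x /=; rewrite ImM.
Qed.

Lemma cmeasurable_cst D z : cmeasurable_fun D (fun _ : T => z : R[i]).
Proof. by split; exact: measurable_cst. Qed.

Lemma cmeasurable_comp d' (T' : measurableType d') (h : T' -> T) f :
  measurable_fun setT h -> cmeasurable_fun setT f ->
  cmeasurable_fun setT (f \o h).
Proof.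
by move=> mh [fr fi]; split; [exact: (measurableT_comp fr mh)|exact: (measurableT_comp fi mh)].
Qed.

Lemma cintegrableP D f : measurable D -> cintegrable mu D f <->
  mu.-integrable D (EFin \o (cRe \o f)) /\
  mu.-integrable D (EFin \o (cIm \o f)).
Proof.
move=> mD; split.
  move=> [[mr mi] foo]; split; apply/integrableP; split.
  - exact/measurable_EFinP.
  - apply: le_lt_trans foo; apply: ge0_le_integral => //=.
    + by apply/measurable_EFinP; exact: measurableT_comp.
    + exact: measurable_EFin_normc.
    + by move=> x _; rewrite lee_fin ler_Re_normc.
  - exact/measurable_EFinP.
  - apply: le_lt_trans foo; apply: ge0_le_integral => //=.
    + by apply/measurable_EFinP; exact: measurableT_comp.
    + exact: measurable_EFin_normc.
    + by move=> x _; rewrite lee_fin ler_Im_normc.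
move=> [/integrableP[/measurable_EFinP mr ir] /integrableP[/measurable_EFinP mi ii]].
split => //.
apply: (@le_lt_trans _ _ (\int[mu]_(x in D)
   ((`|cRe (f x)|)%:E + (`|cIm (f x)|)%:E))%E).
  apply: ge0_le_integral => //=.
  - by move=> x _; rewrite lee_fin normc_ge0.
  - exact: measurable_EFin_normc.
  - by apply: emeasurable_funD; apply/measurable_EFinP; exact: measurableT_comp.
  - by move=> x _; rewrite lee_fin normc_le_ReIm.
rewrite ge0_integralD//=.
- exact: lte_add_pinfty.
- by apply/measurable_EFinP; exact: measurableT_comp.
- by apply/measurable_EFinP; exact: measurableT_comp.
Qed.

Lemma cintegrable_normc D f : measurable D -> cintegrable mu D f ->
  mu.-integrable D (fun x => (normc (f x))%:E).
Proof.
move=> mD [mf foo]; apply/integrableP; split; first exact: measurable_EFin_normc.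
by under eq_integral do rewrite /= ger0_norm ?normc_ge0//.
Qed.

Lemma cintegrableD D f g : measurable D ->
  cintegrable mu D f -> cintegrable mu D g ->
  cintegrable mu D (fun x => f x + g x).
Proof.
move=> mD /cintegrableP[]// fr fi /cintegrableP[]// gr gi.
apply/cintegrableP => //; split.
  rewrite (_ : _ \o _ = (EFin \o (cRe \o f)) \+ (EFin \o (cRe \o g)))%E.
    exact: integrableD.
  by apply/funext => x /=; rewrite ReD.
rewrite (_ : _ \o _ = (EFin \o (cIm \o f)) \+ (EFin \o (cIm \o g)))%E.
  exact: integrableD.
by apply/funext => x /=; rewrite ImD.
Qed.

Lemma cintegral_normZ D f z : measurable D -> cmeasurable_fun D f ->
  (\int[mu]_(x in D) (normc (z * f x))%:E =
   (normc z)%:E * \int[mu]_(x in D) (normc (f x))%:E)%E.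
Proof.
move=> mD mf; under eq_integral do rewrite Normc.normcM EFinM.
rewrite ge0_integralZl//.
- exact: measurable_EFin_normc.
- by move=> x _; rewrite lee_fin normc_ge0.
- by rewrite lee_fin normc_ge0.
Qed.

Lemma cintegrableZ D f z : measurable D ->
  cintegrable mu D f -> cintegrable mu D (fun x => z * f x).
Proof.
move=> mD [mf foo]; split.
  exact: (cmeasurable_funM (cmeasurable_cst D z)).
rewrite cintegral_normZ// lte_mul_pinfty//.
by rewrite lee_fin normc_ge0.
Qed.

Lemma cintegrable_le D f g : measurable D -> cmeasurable_fun D f ->
  (forall x, D x -> normc (f x) <= normc (g x)) ->
  cintegrable mu D g -> cintegrable mu D f.
Proof.
move=> mD mf fg [mg goo]; split => //; apply: le_lt_trans goo.
apply: ge0_le_integral => //=.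
- by move=> x _; rewrite lee_fin normc_ge0.
- exact: measurable_EFin_normc.
- exact: measurable_EFin_normc.
Qed.

Lemma cintegralD D f g : measurable D ->
  cintegrable mu D f -> cintegrable mu D g ->
  cintegral mu D (fun x => f x + g x) = cintegral mu D f + cintegral mu D g.
Proof.
move=> mD /cintegrableP[]// fr fi /cintegrableP[]// gr gi.
rewrite /cintegral.
under eq_Rintegral do rewrite ReD.
under [X in _ +i* X]eq_Rintegral do rewrite ImD.
by rewrite !RintegralD.
Qed.

Let cintegralZ_int D f z : measurable D -> cintegrable mu D f ->
  cintegral mu D (fun x => z * f x) = z * cintegral mu D f.
Proof.
move=> mD /cintegrableP[]// fr fi.
have H a (h : T -> R) : mu.-integrable D (EFin \o h) ->
    mu.-integrable D (EFin \o (fun x => a * h x)).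
  move=> ih; rewrite (_ : _ \o _ = fun x => a%:E * (EFin \o h) x)%E.
    exact: integrableZl.
  by apply/funext => x /=; rewrite EFinM.
rewrite /cintegral.
under eq_Rintegral do rewrite ReM.
under [X in _ +i* X]eq_Rintegral do rewrite ImM.
rewrite RintegralB ?RintegralD//; try exact: H.
rewrite !RintegralZl//.
by apply/eqP; rewrite eq_complex ReM ImM /= !eqxx.
Qed.

Lemma cintegralZ D f z : measurable D ->
  cintegrable mu D (fun x => z * f x) ->
  cintegral mu D (fun x => z * f x) = z * cintegral mu D f.
Proof.
move=> mD izf; have [->|z0] := eqVneq z 0.
  rewrite mul0r /cintegral.
  under eq_Rintegral do rewrite mul0r.
  under [X in _ +i* X]eq_Rintegral do rewrite mul0r.
  by rewrite /= !Rintegral_cst// !mul0r.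
have : cintegral mu D (fun x => z^-1 * (z * f x)) =
    z^-1 * cintegral mu D (fun x => z * f x).
  exact: cintegralZ_int.
rewrite (_ : (fun x => _) = f); last by apply/funext => x; rewrite mulKf.
by move=> ->; rewrite mulVKf.
Qed.

Lemma cintegralZr D f z : measurable D ->
  cintegrable mu D (fun x => f x * z) ->
  cintegral mu D (fun x => f x * z) = cintegral mu D f * z.
Proof.
move=> mD; under eq_fun do rewrite mulrC.
by move=> h; rewrite cintegralZ// mulrC.
Qed.

Lemma eq_cintegral D f g : {in D, f =1 g} ->
  cintegral mu D f = cintegral mu D g.
Proof.
by move=> fg; congr Complex; apply: eq_Rintegral => x xD; rewrite fg.
Qed.

Lemma ae_eq_cintegral D f g : measurable D ->
  cmeasurable_fun D f -> cmeasurable_fun D g ->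
  {ae mu, forall x, D x -> f x = g x} ->
  cintegral mu D f = cintegral mu D g.
Proof.
move=> mD [fr fi] [gr gi] fg.
congr Complex; congr fine; apply: ae_eq_integral => //; try exact/measurable_EFinP.
  by apply: filterS fg => x h Dx; rewrite h.
by apply: filterS fg => x h Dx; rewrite h.
Qed.

Lemma le_normc_cintegral D f : measurable D -> cintegrable mu D f ->
  ((normc (cintegral mu D f))%:E <= \int[mu]_(x in D) (normc (f x))%:E)%E.
Proof.
move=> mD fi; set I := cintegral mu D f.
have [I0|I0] := eqVneq I 0.
  rewrite I0 Normc.normc0; apply: integral_ge0 => x _.
  by rewrite lee_fin normc_ge0.
have nI0 : 0 < normc I.
  rewrite lt_neqAle normc_ge0 andbT eq_sym.
  by apply: contra I0 => /eqP/Normc.eq0_normc ->.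
pose w : R[i] := (normc I)%:C / I.
have nw : normc w = 1.
  rewrite /w Normc.normcM Normc.normcV [normc _%:C]normcE /=.
  by rewrite expr0n addr0 sqrtr_sqr ger0_norm ?normc_ge0// divff ?gt_eqF.
have wI : w * I = (normc I)%:C by rewrite /w divfK.
have fiw : cintegrable mu D (fun x => w * f x) by exact: cintegrableZ.
have : cRe (cintegral mu D (fun x => w * f x)) = normc I.
  by rewrite cintegralZ// wI.
move=> <- /=.
case/(cintegrableP _ mD) : (fiw) => ir _.
rewrite fineK; last exact: integrable_fin_num.
apply: le_trans (_ : \int[mu]_(x in D) (normc (w * f x))%:E <= _)%E.
  apply: le_integral => //.
    exact: cintegrable_normc.
  move=> x _; rewrite lee_fin (le_trans (ler_norm _))//; exact: ler_Re_normc.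
by under eq_integral do rewrite Normc.normcM nw mul1r.
Qed.

End complex_integral_theory.

Section lebesgue_translation.
Context {R : realType}.
Local Notation mu := (@lebesgue_measure R).
Local Open Scope ereal_scope.

Let T := measurableTypeR R.

#[global] Instance lebesgue_ae_filter :
  Filter (nbhs (almost_everywhere (@lebesgue_measure R))).
Proof.
exact: (ae_filter_ringOfSetsType
  (lebesgue_measure : {measure set (measurableTypeR R) -> \bar R})).
Qed.

Lemma measurable_addr (a : R) : measurable_fun [set: T] (fun x : T => x + a : T)%R.
Proof. by apply: measurable_funD => //; exact: measurable_cst. Qed.

Lemma lebesgue_measure_translation (a : R) (A : set R) : measurable A ->
  pushforward mu (fun x : T => x + a : T)%R A = mu A.
Proof.
move=> mA; apply/esym.
have mp : measurable_fun [set: T] (fun x : T => x + a : T)%R.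
  exact: measurable_addr.
pose H := isMeasurableFun.Build _ _ _ _ _ mp.
pose h : {mfun T >-> T} := HB.pack (fun x : T => x + a : T)%R H.
have := @lebesgue_measure_unique R (pushforward mu h).
apply => // _ [[b c]] _ <-.
rewrite [RHS](_ : _ = mu `](b - a)%R, (c - a)%R]%classic); last first.
  rewrite /pushforward; congr (mu _); apply/seteqP.
  by split => x /=; rewrite !in_itv/= ltrBlDr lerBrDr.
rewrite !lebesgue_measure_itv/= !lte_fin ltrD2r.
by case: ifPn => // _; rewrite -!EFinD; congr EFin; rewrite opprB addrA subrK.
Qed.

Lemma ge0_integral_translation (a : R) (f : R -> \bar R) :
  measurable_fun [set: R] f -> (forall x, 0 <= f x) ->
  \int[mu]_x f (x + a)%R = \int[mu]_x f x.
Proof.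
move=> mf f0.
transitivity (\int[pushforward mu (fun x : T => x + a : T)%R]_x f x).
  by rewrite ge0_integral_pushforward//; exact: measurable_addr.
apply: eq_measure_integral => [|mp A mA _]; first exact: measurable_addr.
exact: lebesgue_measure_translation.
Qed.

Lemma integral_translation (a : R) (f : R -> \bar R) :
  measurable_fun [set: R] f ->
  \int[mu]_x f (x + a)%R = \int[mu]_x f x.
Proof.
move=> mf; rewrite [RHS]integralE [LHS]integralE; congr (_ - _).
  rewrite -(ge0_integral_translation a (measurable_funepos mf) (funepos_ge0 f)).
  by apply: eq_integral => x _; rewrite !funeposE.
rewrite -(ge0_integral_translation a (measurable_funeneg mf) (funeneg_ge0 f)).
by apply: eq_integral => x _; rewrite !funenegE.
Qed.

Lemma measurable_subr2 :
  measurable_fun [set: T * T] (fun p : T * T => p.1 - p.2 : T)%R.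
Proof. by apply: measurable_funB. Qed.

Lemma integral_conv_ge0 (A B : R -> \bar R) :
  measurable_fun [set: R] A -> measurable_fun [set: R] B ->
  (forall x, 0 <= A x) -> (forall x, 0 <= B x) ->
  \int[mu]_s \int[mu]_t (A (s - t)%R * B t) = \int[mu]_x A x * \int[mu]_x B x.
Proof.
move=> mA mB A0 B0.
have mAB : measurable_fun [set: T * T] (fun p : T * T => A (p.1 - p.2)%R * B p.2).
  apply: emeasurable_funM; last exact: measurableT_comp.
  exact: (measurableT_comp mA measurable_subr2).
have := @fubini_tonelli _ _ T T R mu mu _ mAB.
move=> -> /=; last by move=> p; exact: mule_ge0.
have AE t : \int[mu]_s (A (s - t)%R * B t) = \int[mu]_x A x * B t.
  have mAt : measurable_fun [set: T] (fun s : T => A (s - t)%R).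
    exact: (measurableT_comp mA (measurable_addr (- t))).
  rewrite (@ge0_integralZr _ T R mu setT measurableT _ mAt)//.
  by rewrite (ge0_integral_translation _ mA).
under eq_integral do rewrite AE.
by rewrite ge0_integralZl// integral_ge0.
Qed.

Lemma measurable_conv_ge0 (A B : R -> \bar R) :
  measurable_fun [set: R] A -> measurable_fun [set: R] B ->
  (forall x, 0 <= A x) -> (forall x, 0 <= B x) ->
  measurable_fun [set: R] (fun s => \int[mu]_t (A (s - t)%R * B t)).
Proof.
move=> mA mB A0 B0.
have mAB : measurable_fun [set: T * T] (fun p : T * T => A (p.1 - p.2)%R * B p.2).
  apply: emeasurable_funM; last exact: measurableT_comp.
  exact: (measurableT_comp mA measurable_subr2).
apply: (@measurable_fun_fubini_tonelli_F _ _ T T R mu _ mAB) => p.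
exact: mule_ge0.
Qed.

End lebesgue_translation.

Section complex_fubini.
Context d1 d2 (T1 : measurableType d1) (T2 : measurableType d2) (R : realType).
Variable m1 : {sigma_finite_measure set T1 -> \bar R}.
Variable m2 : {sigma_finite_measure set T2 -> \bar R}.

Lemma fine_integrable d (T : measurableType d)
    (m : {measure set T -> \bar R}) (h : T -> \bar R) :
  m.-integrable setT h -> m.-integrable setT (EFin \o (fine \o h)) /\
  (\int[m]_x (fine (h x))%:E = \int[m]_x h x)%E.
Proof.
move=> ih; have mh := measurable_int _ ih.
have mfh : measurable_fun setT (EFin \o (fine \o h)).
  by apply/measurable_EFinP; exact: measurableT_comp.
split.
  apply: (le_integrable measurableT mfh _ ih) => x _ /=.
  by case: (h x) => //= *; rewrite ?normr0 ?leey.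
apply: ae_eq_integral => //.
have := integrable_ae measurableT ih.
by apply: filterS => x /(_ I) hx _; rewrite fineK.
Qed.

Lemma integrable_fubini_G (f : T1 * T2 -> \bar R) :
  (m1 \x m2)%E.-integrable setT f ->
  m2.-integrable setT (fun y => \int[m1]_x f (x, y))%E.
Proof.
move=> imf; have mf := measurable_int _ imf; apply/integrableP; split.
  exact: measurable_fubini_G imf.
apply: le_lt_trans ((integrable21ltyP _ _ mf).1 imf).
apply: ge0_le_integral => //.
- by apply: measurableT_comp => //; exact: measurable_fubini_G imf.
- apply: (measurable_fun_fubini_tonelli_G (abse \o f)) => //=.
  exact: measurableT_comp.
- by move=> y _; apply: le_abse_integral => //; apply: measurableT_comp.
Qed.

Lemma cintegrable_ae (K : T1 * T2 -> R[i]) :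
  cintegrable (m1 \x m2)%E setT K ->
  {ae m1, forall x, cintegrable m2 setT (fun y => K (x, y))}.
Proof.
move=> /(cintegrableP _ _ measurableT)[ir ii].
have := ae_integrable1 ii; have := ae_integrable1 ir.
apply: filterS2 => x hr hi; apply/cintegrableP => //.
Qed.

Lemma cintegrable_ae2 (K : T1 * T2 -> R[i]) :
  cintegrable (m1 \x m2)%E setT K ->
  {ae m2, forall y, cintegrable m1 setT (fun x => K (x, y))}.
Proof.
move=> /(cintegrableP _ _ measurableT)[ir ii].
have := ae_integrable2 ii; have := ae_integrable2 ir.
apply: filterS2 => x hr hi; apply/cintegrableP => //.
Qed.

Lemma cintegrable_fubini (K : T1 * T2 -> R[i]) :
  cintegrable (m1 \x m2)%E setT K ->
  cintegrable m1 setT (fun x => cintegral m2 setT (fun y => K (x, y))).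
Proof.
move=> /(cintegrableP _ _ measurableT)[ir ii]; apply/cintegrableP => //.
split.
- exact: (fine_integrable (integrable_fubini_F ir)).1.
- exact: (fine_integrable (integrable_fubini_F ii)).1.
Qed.

Lemma cintegrable_fubini2 (K : T1 * T2 -> R[i]) :
  cintegrable (m1 \x m2)%E setT K ->
  cintegrable m2 setT (fun y => cintegral m1 setT (fun x => K (x, y))).
Proof.
move=> /(cintegrableP _ _ measurableT)[ir ii]; apply/cintegrableP => //.
split.
- exact: (fine_integrable (integrable_fubini_G ir)).1.
- exact: (fine_integrable (integrable_fubini_G ii)).1.
Qed.

Lemma cFubini (K : T1 * T2 -> R[i]) :
  cintegrable (m1 \x m2)%E setT K ->
  cintegral m1 setT (fun x => cintegral m2 setT (fun y => K (x, y))) =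
  cintegral m2 setT (fun y => cintegral m1 setT (fun x => K (x, y))).
Proof.
move=> /(cintegrableP _ _ measurableT)[ir ii]; rewrite /cintegral/=.
congr Complex; congr fine.
- rewrite (fine_integrable (integrable_fubini_F ir)).2.
  rewrite (fine_integrable (integrable_fubini_G ir)).2.
  exact: Fubini.
- rewrite (fine_integrable (integrable_fubini_F ii)).2.
  rewrite (fine_integrable (integrable_fubini_G ii)).2.
  exact: Fubini.
Qed.

End complex_fubini.


Section line_convolution.
Context {R : realType}.
Local Notation mu := (@lebesgue_measure R).
Let T := measurableTypeR R.
Implicit Types F G H : R -> R[i].

Definition fconv F G (s : R) : R[i] :=
  cintegral mu setT (fun t => F (s - t) * G t).

Local Notation L1 F := (cintegrable mu setT F).
Local Notation nm F := (fun x => (normc (F x))%:E).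

Let mnm F : L1 F -> measurable_fun [set: T] (nm F).
Proof. by move=> [mF _]; exact: (@measurable_EFin_normc _ T). Qed.

Let nm0 F x : (0 <= (nm F) x)%E.
Proof. by rewrite lee_fin normc_ge0. Qed.

Lemma cmeasurable_shift F (a : R) : @cmeasurable_fun _ T R setT F ->
  @cmeasurable_fun _ T R setT (fun x => F (x + a)).
Proof. by move=> mF; apply: (cmeasurable_comp (measurable_addr a) mF). Qed.

Lemma cintegrable_shift F (a : R) : L1 F -> L1 (fun x => F (x + a)).
Proof.
move=> [mF Foo]; split; first exact: cmeasurable_shift.
rewrite (@ge0_integral_translation _ a (nm F))//.
exact: (@measurable_EFin_normc _ T).
Qed.

Lemma cintegral_shift F (a : R) : @cmeasurable_fun _ T R setT F ->
  cintegral mu setT (fun x => F (x + a)) = cintegral mu setT F.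
Proof.
move=> [mr mi]; congr Complex; congr fine.
  by rewrite (@integral_translation _ a (EFin \o (cRe \o F)))//; exact/measurable_EFinP.
by rewrite (@integral_translation _ a (EFin \o (cIm \o F)))//; exact/measurable_EFinP.
Qed.

Lemma cmeasurable_conv_kernel F G :
  @cmeasurable_fun _ T R setT F -> @cmeasurable_fun _ T R setT G ->
  cmeasurable_fun setT (fun p : T * T => F (p.1 - p.2) * G p.2).
Proof.
move=> mF mG; apply: cmeasurable_funM.
  exact: (cmeasurable_comp measurable_subr2 mF).
exact: (cmeasurable_comp (measurable_snd) mG).
Qed.

Lemma integral_norm_conv F G : L1 F -> L1 G ->
  (\int[mu]_s \int[mu]_t (normc (F (s - t) * G t))%:E =
   (\int[mu]_x (normc (F x))%:E) * (\int[mu]_x (normc (G x))%:E))%E.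
Proof.
move=> lF lG; rewrite -(integral_conv_ge0 (mnm lF) (mnm lG) (nm0 F) (nm0 G)).
by apply: eq_integral => s _; apply: eq_integral => t _; rewrite Normc.normcM.
Qed.

Lemma cintegrable_conv_kernel F G : L1 F -> L1 G ->
  cintegrable (mu \x mu)%E setT (fun p : T * T => F (p.1 - p.2) * G p.2).
Proof.
move=> lF lG; have mK := cmeasurable_conv_kernel lF.1 lG.1.
split => //.
rewrite (@fubini_tonelli1 _ _ T T R mu mu)/=; last 2 first.
- exact: measurable_EFin_normc.
- by move=> p; rewrite lee_fin normc_ge0.
rewrite /fubini_F/= integral_norm_conv//.
by apply: lte_mul_pinfty; [exact: integral_ge0| |case: lG];
  rewrite ?ge0_fin_numE ?integral_ge0//; case: lF.
Qed.

Lemma cintegrable_conv_ae F G : L1 F -> L1 G ->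
  {ae mu, forall s, cintegrable mu setT (fun t => F (s - t) * G t)}.
Proof. by move=> lF lG; exact: (cintegrable_ae (cintegrable_conv_kernel lF lG)). Qed.

Lemma cintegrable_fconv F G : L1 F -> L1 G -> L1 (fconv F G).
Proof.
by move=> lF lG; exact: (cintegrable_fubini (cintegrable_conv_kernel lF lG)).
Qed.

Lemma le_norm_fconv F G : L1 F -> L1 G ->
  (\int[mu]_s (normc (fconv F G s))%:E <=
   (\int[mu]_x (normc (F x))%:E) * (\int[mu]_x (normc (G x))%:E))%E.
Proof.
move=> lF lG; rewrite -integral_norm_conv//.
apply: ae_ge0_le_integral => //.
- exact: (@measurable_EFin_normc _ T R _ _ (cintegrable_fconv lF lG).1).
- by move=> s _; apply: integral_ge0 => ? _; rewrite lee_fin normc_ge0.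
- have mK := cmeasurable_conv_kernel lF.1 lG.1.
  apply: (@measurable_fun_fubini_tonelli_F _ _ T T R mu
    (fun p => (normc (F (p.1 - p.2) * G p.2))%:E)).
  + exact: measurable_EFin_normc.
  + by move=> p; rewrite lee_fin normc_ge0.
- have := cintegrable_conv_ae lF lG; apply: filterS => s hs _.
  exact: le_normc_cintegral.
Qed.

Lemma fconvDl F F' G : L1 F -> L1 F' -> L1 G ->
  {ae mu, forall s, fconv (fun x => F x + F' x) G s = fconv F G s + fconv F' G s}.
Proof.
move=> lF lF' lG.
have := cintegrable_conv_ae lF lG; have := cintegrable_conv_ae lF' lG.
apply: filterS2 => s h1 h2; rewrite /fconv -cintegralD//.
by apply: eq_cintegral => t _; rewrite mulrDl.
Qed.

Lemma fconvDr F G G' : L1 F -> L1 G -> L1 G' ->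
  {ae mu, forall s, fconv F (fun x => G x + G' x) s = fconv F G s + fconv F G' s}.
Proof.
move=> lF lG lG'.
have := cintegrable_conv_ae lF lG; have := cintegrable_conv_ae lF lG'.
apply: filterS2 => s h1 h2; rewrite /fconv -cintegralD//.
by apply: eq_cintegral => t _; rewrite mulrDr.
Qed.

Lemma fconvZl F G z : L1 F -> L1 G ->
  {ae mu, forall s, fconv (fun x => z * F x) G s = z * fconv F G s}.
Proof.
move=> lF lG; have := cintegrable_conv_ae lF lG.
apply: filterS => s h1; rewrite /fconv -cintegralZ//; last exact: cintegrableZ.
by apply: eq_cintegral => t _; rewrite mulrA.
Qed.

Lemma fconvZr F G z : L1 F -> L1 G ->
  {ae mu, forall s, fconv F (fun x => z * G x) s = z * fconv F G s}.
Proof.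
move=> lF lG; have := cintegrable_conv_ae lF lG.
apply: filterS => s h1; rewrite /fconv -cintegralZ//; last exact: cintegrableZ.
by apply: eq_cintegral => t _; rewrite mulrCA.
Qed.

Lemma fconvA F G H : L1 F -> L1 G -> L1 H ->
  {ae mu, forall s, fconv F (fconv G H) s = fconv (fconv F G) H s}.
Proof.
move=> lF lG lH.
pose P v := (\int[mu]_t (normc (G (v - t) * H t))%:E)%E.
have P0 v : (0 <= P v)%E by apply: integral_ge0 => t _; rewrite lee_fin normc_ge0.
have mP : measurable_fun [set: T] P.
  apply: (@measurable_fun_fubini_tonelli_F _ _ T T R mu
    (fun p => (normc (G (p.1 - p.2) * H p.2))%:E)).
    exact: measurable_EFin_normc (cmeasurable_conv_kernel lG.1 lH.1).
  by move=> p; rewrite lee_fin normc_ge0.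
have iP : (\int[mu]_v P v < +oo)%E.
  rewrite integral_norm_conv//.
  by apply: lte_mul_pinfty; [exact: integral_ge0| |case: lH];
    rewrite ?ge0_fin_numE ?integral_ge0//; case: lG.
have Qoo : {ae mu, forall s, (\int[mu]_v ((nm F) (s - v)%R * P v) < +oo)%E}.
  have iQ : mu.-integrable setT (fun s => \int[mu]_v ((nm F) (s - v)%R * P v))%E.
    apply/integrableP; split.
      by apply: (measurable_conv_ge0 (A := nm F)) => //; exact: mnm.
    under eq_integral.
      move=> s _; rewrite gee0_abs; last first.
        by apply: integral_ge0 => v _; rewrite mule_ge0.
      over.
    rewrite (integral_conv_ge0 (A := nm F))//; last exact: mnm.
    apply: lte_mul_pinfty => //; first exact: integral_ge0.
    by rewrite ge0_fin_numE ?integral_ge0//; case: lF.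
  have := integrable_ae measurableT iQ; apply: filterS => s /(_ Logic.I).
  by rewrite ge0_fin_numE// integral_ge0// => v _; rewrite mule_ge0.
apply: filterS Qoo => s Qs.
pose L (p : T * T) := F (s - p.1) * (G (p.1 - p.2) * H p.2).
have mL : cmeasurable_fun setT L.
  apply: cmeasurable_funM; last exact: cmeasurable_conv_kernel lG.1 lH.1.
  have mF1 : @cmeasurable_fun _ T R setT (fun x => F (s - x)).
    apply: (cmeasurable_comp (h := fun x : T => s - x : T) _ lF.1).
    by apply: measurable_funB => //; exact: measurable_cst.
  exact: (cmeasurable_comp measurable_fst mF1).
have lL : cintegrable (mu \x mu)%E setT L.
  split => //; rewrite (@fubini_tonelli1 _ _ T T R mu mu)/=; last 2 first.
  - exact: measurable_EFin_normc.
  - by move=> p; rewrite lee_fin normc_ge0.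
  apply: le_lt_trans Qs; rewrite /fubini_F/= le_eqVlt; apply/predU1P; left.
  apply: eq_integral => v _.
  have mK := cmeasurable_conv_kernel lG.1 lH.1.
  have mKv : measurable_fun [set: T] (fun t : T => (normc (G (v - t) * H t))%:E).
    apply: (@measurable_EFin_normc _ T R setT (fun t => G (v - t) * H t)).
    split; [exact: (measurableT_comp mK.1 (pair1_measurable v))|
            exact: (measurableT_comp mK.2 (pair1_measurable v))].
  rewrite /P -(@ge0_integralZl _ T R mu setT measurableT _ mKv)//; last first.
    by move=> t _; rewrite lee_fin normc_ge0.
  by apply: eq_integral => t _; rewrite /L/= Normc.normcM EFinM.
transitivity (cintegral mu setT (fun v => cintegral mu setT (fun t => L (v, t)))).
  have iv := cintegrable_ae lL.
  apply: (@ae_eq_cintegral _ T) => //.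
  - apply: cmeasurable_funM; last exact: (cintegrable_fconv lG lH).1.
    apply: (cmeasurable_comp (h := fun x : T => s - x : T) _ lF.1).
    by apply: measurable_funB => //; exact: measurable_cst.
  - exact: (cintegrable_fubini lL).1.
  - apply: filterS iv => v lv _; rewrite /fconv -cintegralZ//.
rewrite (cFubini lL).
have it := cintegrable_ae2 lL.
apply: (@ae_eq_cintegral _ T) => //.
- exact: (cintegrable_fubini2 lL).1.
- apply: cmeasurable_funM; last exact: lH.1.
  apply: (cmeasurable_comp (h := fun x : T => s - x : T) _ (cintegrable_fconv lF lG).1).
  by apply: measurable_funB => //; exact: measurable_cst.
apply: filterS it => t lt _.
rewrite /fconv -(@cintegral_shift (fun x => L (x, t)) t lt.1).
rewrite -cintegralZr//; last first.
  have := @cintegrable_shift _ t lt.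
  congr (cintegrable _ _ _); apply/funext => u.
  by rewrite /L/= addrK opprD addrCA addrA mulrA [_ - u]addrC addrA.
apply: eq_cintegral => u _.
by rewrite /L/= addrK opprD addrCA addrA mulrA [_ - u]addrC addrA.
Qed.

End line_convolution.

Section zero_extension.
Context {R : realType}.
Local Notation mu := (@lebesgue_measure R).
Local Notation I01 := (`[0%R, 1%R]%classic : set R).
Let T := measurableTypeR R.
Implicit Types f g h : R -> R[i].
Local Notation L1 f := (cintegrable mu setT f).

Definition zext f (x : R) : R[i] := if x \in I01 then f x else 0.

Lemma measurable_I01 : @measurable _ T I01.
Proof. exact: measurable_itv. Qed.
Hint Resolve measurable_I01 : core.

Lemma integral_normc_eq0 (D : set R) f : @measurable _ T D ->
  @cmeasurable_fun _ T R D f ->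
  (\int[mu]_(x in D) (normc (f x))%:E = 0)%E <->
  {ae mu, forall x, D x -> f x = 0}.
Proof.
move=> mD mf.
have mn : measurable_fun D (fun x : T => (normc (f x))%:E).
  exact: measurable_EFin_normc.
have -> : (\int[mu]_(x in D) (normc (f x))%:E =
           \int[mu]_(x in D) `| (normc (f x))%:E |)%E.
  by apply: eq_integral => x _; rewrite gee0_abs// lee_fin normc_ge0.
split.
  move/(ae_eq_integral_abs mu mD mn); apply: filterS => x h Dx.
  by apply: Normc.eq0_normc; have [] := h Dx.
move=> h; apply/(ae_eq_integral_abs mu mD mn).
by apply: filterS h => x h Dx; rewrite h// Normc.normc0.
Qed.

Lemma fconv_ae0l f g : L1 f -> L1 g -> {ae mu, forall x, f x = 0} ->
  {ae mu, forall s, fconv f g s = 0}.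
Proof.
move=> lf lg f0.
have lfg := cintegrable_fconv lf lg.
suff /(integral_normc_eq0 measurableT lfg.1) :
    (\int[mu]_x (normc (fconv f g x))%:E = 0)%E.
  by apply: filterS => s; exact.
apply/eqP; rewrite eq_le; apply/andP; split; last first.
  by apply: integral_ge0 => x _; rewrite lee_fin normc_ge0.
apply: (le_trans (le_norm_fconv lf lg)).
have /(integral_normc_eq0 measurableT lf.1) -> :
    {ae mu, forall x, [set: T] x -> f x = 0}.
  by apply: filterS f0 => x h _.
by rewrite mul0e.
Qed.

Lemma fconv_ae0r f g : L1 f -> L1 g -> {ae mu, forall x, g x = 0} ->
  {ae mu, forall s, fconv f g s = 0}.
Proof.
move=> lf lg f0.
have lfg := cintegrable_fconv lf lg.
suff /(integral_normc_eq0 measurableT lfg.1) :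
    (\int[mu]_x (normc (fconv f g x))%:E = 0)%E.
  by apply: filterS => s; exact.
apply/eqP; rewrite eq_le; apply/andP; split; last first.
  by apply: integral_ge0 => x _; rewrite lee_fin normc_ge0.
apply: (le_trans (le_norm_fconv lf lg)).
have /(integral_normc_eq0 measurableT lg.1) -> :
    {ae mu, forall x, [set: T] x -> g x = 0}.
  by apply: filterS f0 => x h _.
by rewrite mule0.
Qed.

Lemma fconv_ae f f' g g' : L1 f -> L1 f' -> L1 g -> L1 g' ->
  {ae mu, forall x, f x = f' x} -> {ae mu, forall x, g x = g' x} ->
  {ae mu, forall s, fconv f g s = fconv f' g' s}.
Proof.
move=> lf lf' lg lg' ff' gg'.
pose df := fun x => f x + (-1) * f' x; pose dg := fun x => g x + (-1) * g' x.
have ldf : L1 df by apply: cintegrableD => //; exact: cintegrableZ.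
have ldg : L1 dg by apply: cintegrableD => //; exact: cintegrableZ.
have df0 : {ae mu, forall x, df x = 0}.
  by apply: filterS ff' => x e; rewrite /df e mulN1r subrr.
have dg0 : {ae mu, forall x, dg x = 0}.
  by apply: filterS gg' => x e; rewrite /dg e mulN1r subrr.
have h1 := fconvDl lf' ldf lg; have h2 := fconvDr lf' lg' ldg.
have h3 := fconv_ae0l ldf lg df0; have h4 := fconv_ae0r lf' ldg dg0.
have e1 : (fun x => f' x + df x) = f.
  by apply/funext => x; rewrite /df mulN1r addrC subrK.
have e2 : (fun x => g' x + dg x) = g.
  by apply/funext => x; rewrite /dg mulN1r addrC subrK.
move: h1 h2; rewrite e1 e2 => h1 h2.
have h34 : {ae mu, forall s, fconv df g s = 0 /\ fconv f' dg s = 0}.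
  by apply: filterS2 h3 h4.
move: h1 h2 h34; apply: filterS3 => s -> -> [-> ->].
by rewrite !addr0.
Qed.

Lemma cmeasurable_zext f :
  @cmeasurable_fun _ T R I01 f <-> @cmeasurable_fun _ T R setT (zext f).
Proof.
have H (p : R[i] -> R) : p 0 = 0 -> @measurable_fun _ _ T R I01 (p \o f) <->
    @measurable_fun _ _ T R setT (p \o zext f).
  move=> p0; apply: (iff_trans (measurable_restrictT (p \o f) measurable_I01)).
  rewrite (_ : (p \o f) \_ I01 = p \o zext f)//.
  by apply/funext => x; rewrite /patch /zext /=; case: ifP.
split=> -[mr mi]; split.
- by apply/(H cRe).
- by apply/(H cIm).
- by apply/(H cRe).
- by apply/(H cIm).
Qed.

Lemma integral_normc_zext f :
  (\int[mu]_(x in I01) (normc (f x))%:E = \int[mu]_x (normc (zext f x))%:E)%E.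
Proof.
rewrite integral_mkcond; apply: eq_integral => x _.
by rewrite /patch /zext; case: ifP; rewrite ?Normc.normc0.
Qed.

Lemma cintegrable_zext f : cintegrable mu I01 f <-> L1 (zext f).
Proof.
by rewrite /cintegrable integral_normc_zext; split => -[/cmeasurable_zext ? ?].
Qed.

Lemma cintegrable_zextT f : L1 f -> cintegrable mu I01 f.
Proof.
move=> [[mr mi] foo]; split.
  by split; [exact: measurable_funS mr|exact: measurable_funS mi].
apply: le_lt_trans foo; apply: ge0_subset_integral => //.
- exact: (@measurable_EFin_normc _ T).
- by move=> x _; rewrite lee_fin normc_ge0.
Qed.

Definition vconv f g (s : R) : R[i] :=
  cintegral mu `[0%R, s]%classic (fun t => f (s - t) * g t).

Lemma zext0 f x : ~ (0 <= x <= 1) -> zext f x = 0.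
Proof. by rewrite /zext => /negP xI; rewrite ifF//; apply/negP; rewrite inE/= in_itv/= (negbTE xI). Qed.

Lemma zextI f x : 0 <= x <= 1 -> zext f x = f x.
Proof. by rewrite /zext => xI; rewrite ifT// inE/= in_itv/=. Qed.

Lemma vconvE f g s : 0 <= s <= 1 -> vconv f g s = fconv (zext f) (zext g) s.
Proof.
move=> /andP[s0 s1]; rewrite /vconv /fconv /cintegral.
have H t : zext f (s - t) * zext g t =
    if t \in `[0%R, s]%classic then f (s - t) * g t else 0.
  case: ifPn; rewrite ?notin_setE ?inE /= in_itv/=.
    move=> /andP[t0 ts]; rewrite !zextI ?t0 ?(le_trans ts)//.
    by rewrite subr_ge0 ts/= lerBlDr (le_trans s1)// lerDl.
  move/negP; rewrite negb_and -!ltNge => /orP[t0|st].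
    by rewrite (@zext0 g) ?mulr0//; apply/negP; rewrite negb_and -ltNge t0.
  rewrite (@zext0 f) ?mul0r//; apply/negP.
  by rewrite negb_and -ltNge subr_lt0 st.
rewrite Rintegral_mkcond [in X in _ +i* X]Rintegral_mkcond.
by congr Complex; apply: eq_Rintegral => t _; rewrite H /patch; case: ifP.
Qed.

Lemma fconv_lt0 f g s : s < 0 -> fconv (zext f) (zext g) s = 0.
Proof.
move=> s0; rewrite /fconv (@eq_cintegral _ T R mu setT _ (fun=> 0 * 0)); last first.
  move=> t _; have [t0|t0] := ltP t 0.
    by rewrite (@zext0 g) ?mulr0//; apply/negP; rewrite negb_and -ltNge t0.
  rewrite (@zext0 f) ?mul0r ?mulr0//; apply/negP.
  by rewrite negb_and -ltNge subr_lt0 (lt_le_trans s0).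
by rewrite /cintegral mul0r !Rintegral_cst// !mul0r.
Qed.

Lemma cintegrable_vconv f g : cintegrable mu I01 f -> cintegrable mu I01 g ->
  cintegrable mu I01 (vconv f g).
Proof.
move=> /cintegrable_zext lf /cintegrable_zext lg.
have := cintegrable_zextT (cintegrable_fconv lf lg).
move=> /cintegrable_zext h; apply/cintegrable_zext.
rewrite (_ : zext (vconv f g) = zext (fconv (zext f) (zext g)))//.
apply/funext => s; rewrite /zext; case: ifPn => //.
by rewrite inE/= in_itv/= => s01; rewrite vconvE.
Qed.

Lemma le_norm_vconv f g : cintegrable mu I01 f -> cintegrable mu I01 g ->
  (\int[mu]_(x in I01) (normc (vconv f g x))%:E <=
   \int[mu]_(x in I01) (normc (f x))%:E * \int[mu]_(x in I01) (normc (g x))%:E)%E.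
Proof.
move=> /cintegrable_zext lf /cintegrable_zext lg.
rewrite !integral_normc_zext; apply: le_trans (le_norm_fconv lf lg).
apply: ge0_le_integral => //.
- by move=> x _; rewrite lee_fin normc_ge0.
- apply: (@measurable_EFin_normc _ T); apply/cmeasurable_zext.
  by have [] := cintegrable_vconv (iffRL (cintegrable_zext _) lf)
    (iffRL (cintegrable_zext _) lg).
- exact: (@measurable_EFin_normc _ T R _ _ (cintegrable_fconv lf lg).1).
- move=> s _; rewrite lee_fin; have [s01|s01] := boolP (0 <= s <= 1).
    by rewrite zextI// vconvE.
  by rewrite zext0 ?Normc.normc0 ?normc_ge0//; exact/negP.
Qed.

Lemma ae_zext f g : {ae mu, forall x, I01 x -> f x = g x} ->
  {ae mu, forall x, zext f x = zext g x}.
Proof.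
by apply: filterS => x h; rewrite /zext; case: ifPn => //; rewrite inE => /h.
Qed.

Lemma vconv_ae f f' g g' :
  cintegrable mu I01 f -> cintegrable mu I01 f' ->
  cintegrable mu I01 g -> cintegrable mu I01 g' ->
  {ae mu, forall x, I01 x -> f x = f' x} ->
  {ae mu, forall x, I01 x -> g x = g' x} ->
  {ae mu, forall s, I01 s -> vconv f g s = vconv f' g' s}.
Proof.
move=> /cintegrable_zext lf /cintegrable_zext lf' /cintegrable_zext lg.
move=> /cintegrable_zext lg' /ae_zext ff' /ae_zext gg'.
have := fconv_ae lf lf' lg lg' ff' gg'; apply: filterS => s h.
by rewrite /= in_itv/= => s01; rewrite !vconvE.
Qed.

Lemma zextD f g : zext (fun x => f x + g x) = (fun x => zext f x + zext g x).
Proof. by apply/funext => x; rewrite /zext; case: ifP; rewrite ?addr0. Qed.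

Lemma zextZ f z : zext (fun x => z * f x) = (fun x => z * zext f x).
Proof. by apply/funext => x; rewrite /zext; case: ifP; rewrite ?mulr0. Qed.

Lemma vconvDl f g h : cintegrable mu I01 f -> cintegrable mu I01 g ->
  cintegrable mu I01 h ->
  {ae mu, forall s, I01 s ->
    vconv (fun x => f x + g x) h s = vconv f h s + vconv g h s}.
Proof.
move=> /cintegrable_zext lf /cintegrable_zext lg /cintegrable_zext lh.
have := fconvDl lf lg lh; apply: filterS => s e.
by rewrite /= in_itv/= => s01; rewrite !vconvE// zextD.
Qed.

Lemma vconvDr f g h : cintegrable mu I01 f -> cintegrable mu I01 g ->
  cintegrable mu I01 h ->
  {ae mu, forall s, I01 s ->
    vconv f (fun x => g x + h x) s = vconv f g s + vconv f h s}.
Proof.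
move=> /cintegrable_zext lf /cintegrable_zext lg /cintegrable_zext lh.
have := fconvDr lf lg lh; apply: filterS => s e.
by rewrite /= in_itv/= => s01; rewrite !vconvE// zextD.
Qed.

Lemma vconvZl f g z : cintegrable mu I01 f -> cintegrable mu I01 g ->
  {ae mu, forall s, I01 s -> vconv (fun x => z * f x) g s = z * vconv f g s}.
Proof.
move=> /cintegrable_zext lf /cintegrable_zext lg.
have := fconvZl z lf lg; apply: filterS => s e.
by rewrite /= in_itv/= => s01; rewrite !vconvE// zextZ.
Qed.

Lemma vconvZr f g z : cintegrable mu I01 f -> cintegrable mu I01 g ->
  {ae mu, forall s, I01 s -> vconv f (fun x => z * g x) s = z * vconv f g s}.
Proof.
move=> /cintegrable_zext lf /cintegrable_zext lg.
have := fconvZr z lf lg; apply: filterS => s e.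
by rewrite /= in_itv/= => s01; rewrite !vconvE// zextZ.
Qed.

Lemma vconvA f g h : cintegrable mu I01 f -> cintegrable mu I01 g ->
  cintegrable mu I01 h ->
  {ae mu, forall s, I01 s -> vconv f (vconv g h) s = vconv (vconv f g) h s}.
Proof.
move=> /cintegrable_zext lf /cintegrable_zext lg /cintegrable_zext lh.
have := fconvA lf lg lh; apply: filterS => s e.
rewrite /= in_itv/= => s01; rewrite !vconvE//.
have [s0 s1] := andP s01.
transitivity (fconv (zext f) (fconv (zext g) (zext h)) s).
  apply: (@eq_cintegral _ T) => v _.
  have [v01|/negP v01] := boolP (0 <= v <= 1).
    by rewrite (zextI (vconv g h))// vconvE.
  rewrite (zext0 (vconv g h))// mulr0; move/negP : v01.
  rewrite negb_and -!ltNge => /orP[v0|v1]; first by rewrite fconv_lt0 ?mulr0.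
  rewrite (@zext0 f) ?mul0r//; apply/negP.
  by rewrite negb_and -ltNge subr_lt0 (le_lt_trans s1).
rewrite e; apply: (@eq_cintegral _ T) => t _.
have [v01|/negP v01] := boolP (0 <= s - t <= 1).
  by rewrite (zextI (vconv f g))// vconvE.
rewrite (zext0 (vconv f g))// mul0r; move/negP : v01.
rewrite negb_and -!ltNge => /orP[v0|v1]; first by rewrite fconv_lt0 ?mul0r.
rewrite (@zext0 h) ?mulr0//; apply/negP.
rewrite negb_and -ltNge; apply/orP; left.
lra.
Qed.

End zero_extension.

(* Non-unital: the library's ring structures all have a unit, which the Volterra
   algebra lacks. The norm of a normed module over [R[i]] is [R[i]]-valued. *)
HB.mixin Record NormedModule_isNormedAlgebra (K : numFieldType) A
    & NormedModule K A := {
  alg_mul : A -> A -> A;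
  alg_mulA : associative alg_mul;
  alg_mulDl : forall x y z, alg_mul (x + y) z = alg_mul x z + alg_mul y z;
  alg_mulDr : forall x y z, alg_mul x (y + z) = alg_mul x y + alg_mul x z;
  alg_mulZl : forall (k : K) x y, alg_mul (k *: x) y = k *: alg_mul x y;
  alg_mulZr : forall (k : K) x y, alg_mul x (k *: y) = k *: alg_mul x y;
  ler_norm_alg_mul : forall x y, `|alg_mul x y| <= `|x| * `|y| }.

#[short(type="normedAlgType")]
HB.structure Definition NormedAlgebra (K : numFieldType) :=
  { A of NormedModule K A & NormedModule_isNormedAlgebra K A }.

Section numerical_range.
Context {R : realType} {A : normedAlgType R[i]}.

Definition unit_sphere : set A := [set x | `|x| = 1].

(* The supremum is over a nonempty set, bounded whenever [phi] is continuous. *)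
Definition dual_norm (phi : A -> R[i]^o) : R :=
  sup [set normc (phi x) | x in [set x : A | `|x| <= 1]].

Definition norming_functionals (x : A) : set {linear A -> R[i]^o} :=
  [set phi | [/\ continuous phi, dual_norm phi = 1 & phi x = 1]].

Definition numerical_range_at (a x : A) : set R[i] :=
  [set phi (alg_mul a x) | phi in norming_functionals x].

Definition numerical_range (a : A) : set R[i] :=
  \bigcup_(x in unit_sphere) numerical_range_at a x.

End numerical_range.

Section volterra.
Variable R : realType.
Local Notation mu := (@lebesgue_measure R).
Local Notation I01 := (`[0%R, 1%R]%classic : set R).
Let T := measurableTypeR R.

Definition L1_pred : {pred R -> R[i]} := [pred f | `[< cintegrable mu I01 f >]].

Lemma L1_predP f : reflect (cintegrable mu I01 f) (f \in L1_pred).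
Proof. exact: asboolP. Qed.

(* Functions are total on [R]; only their values on [[0, 1]] matter, since
   integrability and the equivalence [L1_eqv] look at [[0, 1]] only. *)
Record L1fun := MkL1fun { L1fun_val :> R -> R[i]; L1fun_prop : L1fun_val \in L1_pred }.
HB.instance Definition _ := [isSub for L1fun_val].
HB.instance Definition _ := [Choice of L1fun by <:].

Lemma L1_submod_closed : submod_closed L1_pred.
Proof.
split.
  apply/L1_predP; split; first exact: (@cmeasurable_cst _ T).
  by under eq_integral do rewrite Normc.normc0; rewrite integral0.
move=> a f g /L1_predP fi /L1_predP gi; apply/L1_predP.
apply: (cintegrableD (@measurable_I01 R) _ gi).
exact: (cintegrableZ _ (@measurable_I01 R) fi).
Qed.
HB.instance Definition _ :=
  GRing.isSubmodClosed.Build R[i] (R -> R[i]) L1_pred L1_submod_closed.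
HB.instance Definition _ := [SubChoice_isSubLmodule of L1fun by <:].

Lemma L1funP (f : L1fun) : cintegrable mu I01 f.
Proof. exact/L1_predP/L1fun_prop. Qed.

Lemma L1fun_addE (f g : L1fun) t : (f + g) t = f t + g t. Proof. by []. Qed.
Lemma L1fun_oppE (f : L1fun) t : (- f) t = - f t. Proof. by []. Qed.
Lemma L1fun_scaleE k (f : L1fun) t : (k *: f) t = k * f t. Proof. by []. Qed.

Definition L1_eqv (f g : L1fun) : bool :=
  `[< {ae mu, forall t, I01 t -> f t = g t} >].

Lemma L1_eqv_refl : reflexive L1_eqv.
Proof. by move=> f; apply/asboolP; apply: aeW. Qed.
Lemma L1_eqv_sym : symmetric L1_eqv.
Proof.
by move=> f g; apply/idP/idP => /asboolP h; apply/asboolP; apply: filterS h => t h It; rewrite h.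
Qed.
Lemma L1_eqv_trans : transitive L1_eqv.
Proof.
move=> g f h /asboolP fg /asboolP gh; apply/asboolP.
by apply: filterS2 fg gh => t fg gh It; rewrite fg// gh.
Qed.
Canonical L1_equiv_rel :=
  EquivRel L1_eqv L1_eqv_refl L1_eqv_sym L1_eqv_trans.

Local Open Scope quotient_scope.

Definition volterra : Type := {eq_quot L1_eqv}.
HB.instance Definition _ := Choice.on volterra.
HB.instance Definition _ := EqQuotient.on volterra.

Definition volterra_fun (f : volterra) : R -> R[i] := repr f.

Definition volterra_class (f : L1fun) : volterra := \pi_volterra f.

Lemma volterra_eqP (f g : L1fun) :
  volterra_class f = volterra_class g <->
  {ae mu, forall t, I01 t -> f t = g t}.
Proof.
split; first by move=> /eqmodP/asboolP.
by move=> h; apply/eqmodP/asboolP.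
Qed.

Lemma volterra_classK (f : L1fun) :
  {ae mu, forall t, I01 t -> volterra_fun (volterra_class f) t = f t}.
Proof. by apply/volterra_eqP; rewrite /volterra_class reprK. Qed.

Lemma volterra_funK (f : volterra) : volterra_class (repr f) = f.
Proof. exact: reprK. Qed.

Definition vadd (f g : volterra) := volterra_class (repr f + repr g).
Definition vopp (f : volterra) := volterra_class (- repr f).
Definition vscale (k : R[i]) (f : volterra) := volterra_class (k *: repr f).

Lemma vaddE f g : vadd (volterra_class f) (volterra_class g) = volterra_class (f + g).
Proof.
apply/volterra_eqP; apply: filterS2 (volterra_classK f) (volterra_classK g).
by move=> t hf hg It; rewrite !L1fun_addE -hf// -hg.
Qed.
Lemma voppE f : vopp (volterra_class f) = volterra_class (- f).
Proof.
apply/volterra_eqP; apply: filterS (volterra_classK f).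
by move=> t hf It; rewrite !L1fun_oppE -hf.
Qed.
Lemma vscaleE k f : vscale k (volterra_class f) = volterra_class (k *: f).
Proof.
apply/volterra_eqP; apply: filterS (volterra_classK f).
by move=> t hf It; rewrite !L1fun_scaleE -hf.
Qed.

Lemma volterraP (P : volterra -> Prop) :
  (forall f, P (volterra_class f)) -> forall f, P f.
Proof. by move=> h f; rewrite -(volterra_funK f). Qed.

Lemma vaddA : associative vadd.
Proof.
elim/volterraP => f; elim/volterraP => g; elim/volterraP => h.
by rewrite !vaddE addrA.
Qed.
Lemma vaddC : commutative vadd.
Proof.
by elim/volterraP => f; elim/volterraP => g; rewrite !vaddE addrC.
Qed.
Lemma vadd0 : left_id (volterra_class 0) vadd.
Proof. by elim/volterraP => f; rewrite vaddE add0r. Qed.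
Lemma vaddN : left_inverse (volterra_class 0) vopp vadd.
Proof. by elim/volterraP => f; rewrite voppE vaddE addNr. Qed.
HB.instance Definition _ :=
  GRing.isZmodule.Build volterra vaddA vaddC vadd0 vaddN.

Lemma vscaleA a b v : vscale a (vscale b v) = vscale (a * b) v.
Proof. by elim/volterraP: v => f; rewrite !vscaleE scalerA. Qed.
Lemma vscale1 : left_id 1 vscale.
Proof. by elim/volterraP => f; rewrite vscaleE scale1r. Qed.
Lemma vscaleDr : right_distributive vscale +%R.
Proof.
move=> a; elim/volterraP => f; elim/volterraP => g.
by rewrite [_ + _]vaddE !vscaleE [RHS]vaddE scalerDr.
Qed.
Lemma vscaleDl v : {morph vscale^~ v : a b / a + b}.
Proof.
move=> a b; elim/volterraP: v => f.
by rewrite !vscaleE [RHS]vaddE scalerDl.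
Qed.
HB.instance Definition _ :=
  GRing.Zmodule_isLmodule.Build R[i] volterra vscaleA vscale1 vscaleDr vscaleDl.

Definition l1norm (f : R -> R[i]) : R := \int[mu]_(t in I01) normc (f t).

Lemma l1normE (f : L1fun) :
  (l1norm f)%:E = (\int[mu]_(t in I01) (normc (f t))%:E)%E.
Proof.
rewrite fineK// ge0_fin_numE; first by case: (L1funP f).
by apply: integral_ge0 => t _; rewrite lee_fin normc_ge0.
Qed.

Lemma l1norm_ae (f g : L1fun) : {ae mu, forall t, I01 t -> f t = g t} ->
  l1norm f = l1norm g.
Proof.
move=> fg; congr fine; apply: ae_eq_integral.
- exact: measurable_I01.
- exact: (measurable_EFin_normc (L1funP f).1).
- exact: (measurable_EFin_normc (L1funP g).1).
- by apply: filterS fg => t h It; rewrite h.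
Qed.

Definition vnorm (f : volterra) : R[i] := (l1norm (volterra_fun f))%:C.

Lemma vnormE (f : L1fun) : vnorm (volterra_class f) = (l1norm f)%:C.
Proof. congr (_%:C); apply: l1norm_ae; exact: volterra_classK. Qed.

Lemma ler_vnormD f g : vnorm (f + g) <= vnorm f + vnorm g.
Proof.
elim/volterraP: f => f; elim/volterraP: g => g.
rewrite [f in vnorm f]vaddE !vnormE -rmorphD/= lecR -lee_fin EFinD !l1normE.
have mf := measurable_EFin_normc (L1funP f).1.
have mg := measurable_EFin_normc (L1funP g).1.
have n0 (h : L1fun) t : I01 t -> (0 <= (normc (h t))%:E)%E.
  by move=> _; rewrite lee_fin normc_ge0.
rewrite -(ge0_integralD mu (@measurable_I01 R) (n0 f) mf (n0 g) mg).
rewrite (l1normE (f + g)).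
apply: ge0_le_integral.
- exact: measurable_I01.
- by move=> t _; rewrite lee_fin normc_ge0.
- exact: (measurable_EFin_normc (L1funP (f + g)).1).
- by apply: emeasurable_funD; [exact: (measurable_EFin_normc (L1funP f).1)|
     exact: (measurable_EFin_normc (L1funP g).1)].
- by move=> t _; rewrite -EFinD lee_fin normcD.
Qed.

Lemma vnormZ k f : vnorm (k *: f) = `|k| * vnorm f.
Proof.
elim/volterraP: f => f.
rewrite [f in vnorm f]vscaleE !vnormE normC_normc -rmorphM/=; congr (_%:C).
apply: EFin_inj; rewrite EFinM (l1normE f) (l1normE (k *: f)).
by rewrite -(cintegral_normZ mu k (@measurable_I01 R) (L1funP f).1).
Qed.

Lemma vnorm_eq0 f : vnorm f = 0 -> f = 0.
Proof.
elim/volterraP: f => f; rewrite vnormE => /complexI f0.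
apply/volterra_eqP.
have := l1normE f; rewrite f0 => /esym.
by move/(integral_normc_eq0 (@measurable_I01 R) (L1funP f).1).
Qed.

HB.instance Definition _ := Lmodule_isNormed.Build R[i] volterra
  ler_vnormD vnormZ vnorm_eq0.

Definition L1conv (f g : L1fun) : L1fun :=
  MkL1fun (introT (L1_predP _) (cintegrable_vconv (L1funP f) (L1funP g))).

Definition vmul (f g : volterra) : volterra :=
  volterra_class (L1conv (repr f) (repr g)).

Lemma vmulE f g :
  vmul (volterra_class f) (volterra_class g) = volterra_class (L1conv f g).
Proof.
by apply/volterra_eqP; apply: vconv_ae;
  [exact: L1funP..|exact: volterra_classK|exact: volterra_classK].
Qed.

Lemma vmulA : associative vmul.
Proof.
elim/volterraP => f; elim/volterraP => g; elim/volterraP => h.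
rewrite !vmulE; apply/volterra_eqP.
exact: (vconvA (L1funP f) (L1funP g) (L1funP h)).
Qed.
Lemma vmulDl (f g h : volterra) : vmul (f + g) h = vmul f h + vmul g h.
Proof.
elim/volterraP: f => f; elim/volterraP: g => g; elim/volterraP: h => h.
rewrite [_ + _]vaddE !vmulE [RHS]vaddE; apply/volterra_eqP.
exact: (vconvDl (L1funP f) (L1funP g) (L1funP h)).
Qed.
Lemma vmulDr (f g h : volterra) : vmul f (g + h) = vmul f g + vmul f h.
Proof.
elim/volterraP: f => f; elim/volterraP: g => g; elim/volterraP: h => h.
rewrite [_ + _]vaddE !vmulE [RHS]vaddE; apply/volterra_eqP.
exact: (vconvDr (L1funP f) (L1funP g) (L1funP h)).
Qed.
Lemma vmulZl k (f g : volterra) : vmul (k *: f) g = k *: vmul f g.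
Proof.
elim/volterraP: f => f; elim/volterraP: g => g.
rewrite [_ *: _]vscaleE !vmulE [RHS]vscaleE; apply/volterra_eqP.
exact: (vconvZl k (L1funP f) (L1funP g)).
Qed.
Lemma vmulZr k (f g : volterra) : vmul f (k *: g) = k *: vmul f g.
Proof.
elim/volterraP: f => f; elim/volterraP: g => g.
rewrite [_ *: _]vscaleE !vmulE [RHS]vscaleE; apply/volterra_eqP.
exact: (vconvZr k (L1funP f) (L1funP g)).
Qed.
Lemma ler_norm_vmul (f g : volterra) : `|vmul f g| <= `|f| * `|g|.
Proof.
rewrite -[leLHS]/(vnorm _) -[leRHS]/(vnorm f * vnorm g).
elim/volterraP: f => f; elim/volterraP: g => g.
rewrite vmulE !vnormE -rmorphM/= lecR -lee_fin EFinM.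
rewrite (l1normE (L1conv f g)) (l1normE f) (l1normE g).
exact: (le_norm_vconv (L1funP f) (L1funP g)).
Qed.

HB.instance Definition _ := NormedModule_isNormedAlgebra.Build R[i] volterra
  vmulA vmulDl vmulDr vmulZl vmulZr ler_norm_vmul.

(* The complement in [[0, 1]] of the largest relatively open subset on which [f]
   vanishes almost everywhere. *)
Definition essential_support (f : volterra) : set R :=
  [set x | I01 x /\ forall U : set R, nbhs x U ->
     ~ {ae mu, forall t, I01 t -> U t -> volterra_fun f t = 0}].

(* In [R[i]], [0 <= z] means that [z] is real and nonnegative. *)
Definition volterra_ge0 (f : volterra) : Prop :=
  {ae mu, forall t, I01 t -> 0 <= volterra_fun f t}.

End volterra.

Definition closed_unit_disc {R : realType} : set R[i] := [set z | `|z| <= 1].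

(* Main.v *)
Require Import Defs.
From HB Require Import structures.
From mathcomp Require Import all_boot all_order all_algebra complex.
From mathcomp Require Import all_classical all_reals all_analysis.
From mathcomp Require Import measurable_realfun ring lra.
Import Order.TTheory GRing.Theory Num.Theory.
Import numFieldNormedType.Exports.
Local Open Scope classical_set_scope.
Local Open Scope complex_scope.
Local Open Scope ring_scope.

(** Choose [d > 0] such that [f] vanishes almost everywhere outside
    [(d, 1 - d)]. If [g] is [1 / d] on [[0, d]] and [0] elsewhere, then
    [f * g] is supported in [[d, 1]] and, both functions being nonnegative,
    [\int (f * g) = |f|]. For [|w| <= 1], integration against the function
    that is [1] on [[0, d]] and [w] on [(d, 1]] is a functional of norm [1]
    with value [1] at [g] and [w |f|] at [f * g]. *)

Local Notation cRe := (@complex.Re _).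
Local Notation cIm := (@complex.Im _).
Local Notation normc := (@Normc.normc _).

(** * Norming functionals and the inclusion in the disc *)

Section dual_norm_theory.
Context {R : realType} {A : normedAlgType R[i]}.
Implicit Types (phi : {linear A -> R[i]^o}) (a x : A).

(** Scale [y] to norm 1. [has_sup] is assumed because for an unbounded functional [dual_norm] is the
    default value of [sup] and bounds nothing. The norm on [A] is complex-valued, and [normc] brings
    it back to the reals. *)
Lemma le_dual_norm phi y :
  has_sup [set normc (phi x) | x in [set x : A | `|x| <= 1]] ->
  normc (phi y) <= dual_norm phi * normc `|y|.
Proof.
move=> [_ ub].
have H z : `|z| <= 1 -> normc (phi z) <= dual_norm phi.
  by move=> z1; apply: ub_le_sup => //; exists z.
have [y0|y0] := eqVneq `|y| 0.
  by rewrite y0 (normr0_eq0 y0) linear0 Normc.normc0 mulr0.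
have := H (`|y|^-1 *: y).
rewrite linearZ normrZ normfV normr_id mulVf// => /(_ (lexx _)).
rewrite Normc.normcM Normc.normcV ler_pdivrMl ?[_ * dual_norm _]mulrC//.
rewrite lt_neqAle normc_ge0 andbT eq_sym.
by apply: contra y0 => /eqP/Normc.eq0_normc/eqP.
Qed.

(* An unbounded functional has [dual_norm] 0, the junk value of [sup], so
   [dual_norm phi = 1] forces boundedness. *)
Lemma numerical_range_sub_disc a :
  numerical_range a `<=` [set `|a| * z | z in @closed_unit_disc R].
Proof.
move=> _ [x x1 [phi [_ n1 _] <-]].
have hs : has_sup [set normc (phi x) | x in [set x : A | `|x| <= 1]].
  by apply: contrapT => /sup_out; rewrite -/(dual_norm phi) n1 => /eqP; rewrite oner_eq0.
have h : normc (phi (alg_mul a x)) <= normc `|a|.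
  apply: (le_trans (le_dual_norm _ _ hs)); rewrite n1 mul1r -lecR -!normC_normc !normr_id.
  by have := ler_norm_alg_mul a x; rewrite x1 mulr1.
(* If the norm of [a] is 0, this quotient is 0, and [h] forces [phi (alg_mul a x)] to be 0 as
   well. *)
exists (phi (alg_mul a x) / `|a|); last first.
  have [a0|a0] := eqVneq `|a| 0; last by rewrite mulrC divfK.
  apply/esym; rewrite a0 mul0r; move: h; rewrite a0 Normc.normc0 => h.
  by apply/Normc.eq0_normc/eqP; rewrite eq_le h normc_ge0.
rewrite /closed_unit_disc/= normrM normfV normr_id.
have [a0|a0] := eqVneq `|a| 0; first by rewrite a0 invr0 mulr0.
rewrite ler_pdivrMr ?mul1r; last by rewrite lt_neqAle eq_sym a0 normr_ge0.
by rewrite -[X in _ <= X]normr_id !normC_normc lecR.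
Qed.

(** Domination by the norm yields both continuity and dual norm at most 1; the unit vector [x] shows
    that 1 is attained. *)
Lemma norming_functionalI phi x : `|x| = 1 -> phi x = 1 ->
  (forall y, `|phi y : R[i]| <= `|y|) -> norming_functionals x phi.
Proof.
move=> x1 px ple; split => //.
  apply/linear_bounded_continuous/linear_boundedP; exists 1; split => //.
  by move=> r r1 y; rewrite (le_trans (ple y))// ler_peMl// ltW.
apply/le_anti/andP; split.
  apply: ge_sup; first by exists (normc (phi x)); exists x => //=; rewrite x1.
  move=> _ [y /= y1 <-]; rewrite -lecR -normC_normc (le_trans (ple _))//.
apply: ub_le_sup.
  by exists 1 => _ [y /= y1 <-]; rewrite -lecR -normC_normc (le_trans (ple _)).
by exists x => /=; rewrite ?x1// px /= expr0n addr0 expr1n sqrtr1.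
Qed.

End dual_norm_theory.

(** [Rcomplex R] is the complex plane as a real vector space, so the weights are real. A combination
    of multiples of [c] is [c] times a combination of points of the unit disc, which stays there by
    the triangle inequality. *)
Lemma convex_disc (R : realType) (c : R[i]) :
  convex_set ([set c * z | z in @closed_unit_disc R] : set (Rcomplex R)).
Proof.
apply/convex_setW => x y; rewrite !inE => -[z z1 <-] [w w1 <-] l l0 l1.
set k := l%:num in l0 l1; rewrite inE.
exists (k%:C * z + (1 - k)%:C * w).
  move: z1 w1; rewrite /closed_unit_disc/= => z1 w1.
  rewrite (le_trans (ler_normD _ _))// !normrM.
  have nk : `|k%:C| = k%:C by rewrite ger0_norm// lecR ltW.
  have nk' : `|(1 - k)%:C| = (1 - k)%:C by rewrite ger0_norm// lecR subr_ge0 ltW.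
  rewrite nk nk' -[leRHS](_ : k%:C * 1 + (1 - k)%:C * 1 = 1); last first.
    by rewrite !mulr1 -rmorphD/= addrC subrK.
  by rewrite lerD// ler_wpM2l// lecR ?subr_ge0 ltW.
rewrite /conv/= -/k /unstable.onem.
case: c z w {z1 w1} => [a b] [a1 b1] [a2 b2].
by apply/eqP; rewrite eq_complex /=; apply/andP; split; apply/eqP; clearbody k; ring.
Qed.

(** * Complex-valued integrable and measurable functions *)

Lemma cintegrableZr d (T : measurableType d) (R : realType)
    (mu : {measure set T -> \bar R}) (D : set T) (f : T -> R[i]) (z : R[i]) :
  measurable D -> cintegrable mu D f -> cintegrable mu D (fun x => f x * z).
Proof.
move=> mD fi; rewrite (_ : (fun x => _) = (fun x => z * f x)).
  exact: cintegrableZ.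
by apply/funext => x; rewrite mulrC.
Qed.

Lemma cmeasurable_ifT d (T : measurableType d) (R : realType) (b : T -> bool)
    (F G : T -> R[i]) :
  measurable_fun setT b ->
  cmeasurable_fun setT F -> cmeasurable_fun setT G ->
  cmeasurable_fun setT (fun t => if b t then F t else G t).
Proof.
move=> mb [Fr Fi] [Gr Gi]; split.
  rewrite (_ : _ \o _ = (fun t => if b t then (cRe \o F) t else (cRe \o G) t)).
    exact: measurable_fun_ifT.
  by apply/funext => t /=; case: ifP.
rewrite (_ : _ \o _ = (fun t => if b t then (cIm \o F) t else (cIm \o G) t)).
  exact: measurable_fun_ifT.
by apply/funext => t /=; case: ifP.
Qed.

(** * The integral of a convolution *)

Section convolution_integral.
Context {R : realType}.
Local Notation mu := (@lebesgue_measure R).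
Let T := measurableTypeR R.
Local Notation L1 f := (cintegrable mu setT f).

(** By Fubini one integrates in [s] first; translation invariance makes the integral of [F (s - t)]
    independent of [t], so it factors out. *)
Lemma cintegral_fconv {F G : R -> R[i]} : L1 F -> L1 G ->
  cintegral mu setT (fconv F G) = cintegral mu setT F * cintegral mu setT G.
Proof.
move=> lF lG; rewrite /fconv (cFubini (cintegrable_conv_kernel lF lG))/=.
rewrite -(cintegralZ (measurableT : @measurable _ T setT)); last exact: cintegrableZ.
apply: (@eq_cintegral _ T) => t _.
rewrite (@cintegralZr _ T)//; first by rewrite (cintegral_shift (- t) lF.1).
by apply: cintegrableZr => //; exact: (@cintegrable_shift _ F (- t)).
Qed.

End convolution_integral.

(** * Functionals given by integration against a function bounded by 1 *)

Section volterra_functional.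
Context {R : realType}.
Local Notation mu := (@lebesgue_measure R).
Local Notation I01 := (`[0%R, 1%R]%classic : set R).
Let T := measurableTypeR R.

Variable u : R -> R[i].
Hypothesis um : @cmeasurable_fun _ T R I01 u.
Hypothesis u1 : forall t, I01 t -> normc (u t) <= 1.

Lemma cintegrable_mulr_le1 (h : L1fun R) : cintegrable mu I01 (fun t => h t * u t).
Proof.
have mI := @measurable_I01 R.
apply: (cintegrable_le mI _ _ (L1funP h)).
  exact: (@cmeasurable_funM _ T R _ _ _ (L1funP h).1 um).
by move=> t It; rewrite Normc.normcM ler_piMr ?normc_ge0// u1.
Qed.

Definition volterra_pairing (h : volterra R) : R[i]^o :=
  cintegral mu I01 (fun t => volterra_fun h t * u t).

(** The chosen representative agrees with [h] almost everywhere on the unit interval. Linearity and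
    the norm bound can thus be checked on functions. *)
Lemma volterra_pairing_class (h : L1fun R) :
  volterra_pairing (volterra_class h) = cintegral mu I01 (fun t => h t * u t).
Proof.
apply: (@ae_eq_cintegral _ T).
- exact: measurable_I01.
- exact: (cintegrable_mulr_le1 _).1.
- exact: (cintegrable_mulr_le1 _).1.
- by apply: filterS (volterra_classK h) => t /[apply] ->.
Qed.

Lemma volterra_pairing_linear : linear volterra_pairing.
Proof.
move=> k g h; rewrite -(volterra_funK g) -(volterra_funK h).
rewrite [k *: _]vscaleE [_ + volterra_class _]vaddE !volterra_pairing_class.
rewrite -[X in _ = X + _](@cintegralZ _ T R mu _ _ k); last 2 first.
- exact: measurable_I01.
- by apply: cintegrableZ; [exact: measurable_I01|exact: cintegrable_mulr_le1].
rewrite -(@cintegralD _ T)//.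
- by apply: (@eq_cintegral _ T) => t _; rewrite mulrDl mulrA.
- by apply: cintegrableZ; [exact: measurable_I01|exact: cintegrable_mulr_le1].
- exact: cintegrable_mulr_le1.
Qed.

Lemma volterra_pairing_le h : `|volterra_pairing h : R[i]| <= `|h|.
Proof.
rewrite -(volterra_funK h) volterra_pairing_class.
rewrite [leRHS]vnormE normC_normc lecR -lee_fin l1normE.
apply: (le_trans (le_normc_cintegral (@measurable_I01 R) (cintegrable_mulr_le1 _))).
apply: ge0_le_integral.
- exact: measurable_I01.
- by move=> t _; rewrite lee_fin normc_ge0.
- exact: (measurable_EFin_normc (cintegrable_mulr_le1 _).1).
- exact: (measurable_EFin_normc (L1funP _).1).
- by move=> t It; rewrite lee_fin Normc.normcM ler_piMr ?normc_ge0// u1.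
Qed.

End volterra_functional.

(** * Integrals on the unit interval and the reverse inclusion *)

Section unit_interval.
Context {R : realType}.
Local Notation mu := (@lebesgue_measure R).
Local Notation I01 := (`[0%R, 1%R]%classic : set R).
Let T := measurableTypeR R.

Lemma not_essential_supportP (f : volterra R) (x : R) : I01 x ->
  ~ essential_support f x -> exists2 e : R, 0 < e &
    {ae mu, forall t, I01 t -> `|x - t| < e -> volterra_fun f t = 0}.
Proof.
move=> Ix nx; have [U [/nbhs_ballP[e /= e0 eU] fU]] : exists U : set R, nbhs x U /\
    {ae mu, forall t, I01 t -> U t -> volterra_fun f t = 0}.
  apply: contrapT => h; apply: nx; split => // U nU aeU; apply: h; by exists U.
by exists e => //; apply: filterS fU => t h It xt; apply: h => //; exact: eU.
Qed.

Lemma cmeasurable_ifle (e : R) (z w : R[i]) :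
  @cmeasurable_fun _ T R I01 (fun t => if t <= e then z else w).
Proof.
have [mr mi] := @cmeasurable_ifT _ T R (fun t : R => t <= e) (fun=> z) (fun=> w)
  (measurable_fun_ler (@measurable_id _ T setT) (measurable_cst e))
  (@cmeasurable_cst _ T R setT z) (@cmeasurable_cst _ T R setT w).
by split; apply: measurable_funTS.
Qed.

Lemma cintegral_zext (f : R -> R[i]) :
  cintegral mu I01 f = cintegral mu setT (zext f).
Proof.
rewrite /cintegral Rintegral_mkcond [in X in _ +i* X]Rintegral_mkcond.
by congr Complex; apply: eq_Rintegral => t _; rewrite /patch /zext; case: ifP.
Qed.

Lemma zext_id (f : R -> R[i]) : (forall x, ~ (0 <= x <= 1) -> f x = 0) ->
  zext f = f.
Proof.
move=> f0; apply/funext => x; have [x01|/negP x01] := boolP (0 <= x <= 1).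
  exact: zextI.
by rewrite zext0 ?f0.
Qed.

(** A nonnegative function equals its modulus, and its imaginary part is 0. This is how positivity
    turns integrals into norms, both for the box and for the given element. *)
Lemma cintegral_ge0 (f : R -> R[i]) : (forall t, I01 t -> 0 <= f t) ->
  cintegral mu I01 f = (l1norm f)%:C.
Proof.
move=> f0; have fE t : t \in I01 -> f t = (normc (f t))%:C.
  by rewrite inE => /f0 ft0; rewrite -normC_normc ger0_norm.
rewrite (@eq_cintegral _ T R mu _ _ _ fE); congr Complex.
by rewrite /= Rintegral_cst ?mul0r//; exact: measurable_I01.
Qed.

(* Only the values on [[0, 1]] matter. *)
Definition box (d t : R) : R[i] := if t <= d then (d^-1)%:C else 0.

Lemma box_ge0 (d t : R) : 0 <= d -> 0 <= box d t.
Proof. by move=> d0; rewrite /box; case: ifP => // _; rewrite lecR invr_ge0. Qed.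

Lemma cintegrable_box {d : R} : 0 <= d -> cintegrable mu I01 (box d).
Proof.
move=> d0; have mI := @measurable_I01 R.
apply: (cintegrable_le mI (g := fun=> (d^-1)%:C)).
- exact: cmeasurable_ifle.
- move=> t _; rewrite /box; case: ifP => // _.
  by rewrite Normc.normc0 normc_ge0.
- split; first exact: (@cmeasurable_cst _ T R).
  rewrite integral_cst//= lebesgue_measure_itv/= lte_fin ltr01.
  by rewrite -EFinB -EFinM ltry.
Qed.

(** As [d <= 1], the whole interval from 0 to [d] lies in the domain and contributes [d * d^-1]. *)
Lemma cintegral_box {d : R} : 0 < d <= 1 -> cintegral mu I01 (box d) = 1.
Proof.
move=> /andP[d0 d1]; rewrite cintegral_ge0; last first.
  by move=> t _; exact/box_ge0/ltW.
congr (_%:C); rewrite /l1norm Rintegral_mkcond.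
transitivity (\int[mu]_(t in `[0%R, d]) d^-1).
  rewrite [RHS]Rintegral_mkcond; apply: eq_Rintegral => t _.
  rewrite /patch /box !mem_setE !in_itv/=.
  have [t0|] := leP 0 t => //=; have [td|td] := leP t d => /=.
    by rewrite (le_trans td)//= expr0n addr0 sqrtr_sqr ger0_norm ?invr_ge0 ?ltW.
  by rewrite expr0n addr0 sqrtr0 if_same.
rewrite Rintegral_cst//= lebesgue_measure_itv/= lte_fin d0.
by rewrite -EFinB/= subr0 mulVf ?gt_eqF.
Qed.

(** * Convolution with the box *)

Section convolution_with_box.
Variables (d : R) (f : R -> R[i]).
(** Vanishing is required at every point, so that the convolution also vanishes pointwise; a
    suitable representative is chosen later. *)
Hypotheses (d01 : 0 < d <= 1) (f0 : forall t, ~~ (d < t < 1 - d) -> f t = 0).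
Hypothesis lf : cintegrable mu setT f.

Let zfE : zext f = f.
Proof.
have /andP[d0 _] := d01.
apply: zext_id => x x01; apply: f0; apply/negP => /andP[dx x1]; apply: x01.
by apply/andP; split; lra.
Qed.

(** A nonzero integrand needs [0 <= t <= d] and [d < s - t < 1 - d]; adding these places [s]
    strictly between [d] and 1. *)
Lemma fconv_box0 s : ~~ (d < s <= 1) -> fconv f (zext (box d)) s = 0.
Proof.
have shift (t : R) : 0 <= t -> t <= d -> d < s - t -> s - t < 1 - d -> d < s <= 1.
  by move=> ? ? ? ?; apply/andP; split; lra.
move=> sd; rewrite /fconv (@eq_cintegral _ T R mu setT _ (fun=> 0 * 0)); last first.
  move=> t _; have [t01|/negP t01] := boolP (0 <= t <= 1); last first.
    by rewrite (zext0 _ t01) !mulr0.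
  rewrite (zextI _ t01) /box; case: ifP; rewrite ?mulr0// => td.
  have [t0 _] := andP t01; rewrite f0 ?mul0r ?mulr0//.
  by apply: contraNN sd => /andP[]; exact: shift.
by rewrite /cintegral mul0r !Rintegral_cst// !mul0r.
Qed.

Lemma cintegral_vconv_box (w : R[i]) :
  cintegral mu I01 (fun s => vconv f (box d) s * (if s <= d then 1 else w)) =
  cintegral mu I01 f * w.
Proof.
have mI := @measurable_I01 R.
have [d0 _] := andP d01.
have lb := cintegrable_box (ltW d0).
have lI : cintegrable mu I01 f by exact: cintegrable_zextT.
(* The weight differs from [w] only for [s <= d], where the convolution vanishes. *)
rewrite (@eq_cintegral _ T R mu I01 _ (fun s => vconv f (box d) s * w)); last first.
  move=> s; rewrite inE/= in_itv/= => s01; rewrite vconvE// zfE.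
  case: ifP => // sd; rewrite fconv_box0 ?mul0r//.
  by rewrite ltNge sd.
rewrite (@cintegralZr _ T)//; last first.
  by apply: cintegrableZr => //; exact: cintegrable_vconv.
congr (_ * _); rewrite [LHS]cintegral_zext.
(* No mass is lost by truncating at 1: the convolution on the line already vanishes outside the unit
   interval. Hence its integral is the product of the two integrals. *)
have -> : zext (vconv f (box d)) = fconv f (zext (box d)).
  apply/funext => s; have [s01|/negP s01] := boolP (0 <= s <= 1).
    by rewrite zextI// vconvE// zfE.
  rewrite zext0// fconv_box0//; apply/negP => /andP[? ?]; apply: s01.
  by apply/andP; split; lra.
rewrite cintegral_fconv//; last exact/cintegrable_zext.
by rewrite -cintegral_zext cintegral_box// mulr1 cintegral_zext zfE.
Qed.

End convolution_with_box.

Lemma disc_sub_numerical_range (f : volterra R) : volterra_ge0 f ->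
  ~ essential_support f 0 -> ~ essential_support f 1 ->
  [set `|f| * z | z in @closed_unit_disc R] `<=` numerical_range f.
Proof.
move=> f_ge0 f_supp0 f_supp1.
have [e0 e0_gt0 fe0] : exists2 e : R, 0 < e &
    {ae mu, forall t, I01 t -> `|0 - t| < e -> volterra_fun f t = 0}.
  by apply: not_essential_supportP => //=; rewrite in_itv/= lexx ler01.
have [e1 e1_gt0 fe1] : exists2 e : R, 0 < e &
    {ae mu, forall t, I01 t -> `|1 - t| < e -> volterra_fun f t = 0}.
  by apply: not_essential_supportP => //=; rewrite in_itv/= lexx ler01.
(* The minimum with 1 keeps the box inside the unit interval; halving makes the comparisons with
   [e0] and [e1] strict, so the closed ranges [t <= d] and [1 - d <= t] are covered. *)
pose d := Num.min 1 (Num.min e0 e1) / 2.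
have [d_gt0 d1 de0 de1] : [/\ 0 < d, d < 1, d < e0 & d < e1].
  rewrite /d; have m0 : 0 < Num.min 1 (Num.min e0 e1) by rewrite !lt_min ltr01 e0_gt0.
  have m1 : Num.min 1 (Num.min e0 e1) <= 1 by rewrite ge_min lexx.
  have m2 : Num.min 1 (Num.min e0 e1) <= e0 by rewrite !ge_min lexx orbT.
  have m3 : Num.min 1 (Num.min e0 e1) <= e1 by rewrite !ge_min lexx !orbT.
  by split; lra.
have d01 : 0 < d <= 1 by rewrite d_gt0 ltW.
(* A representative of [f] for which the properties known almost everywhere hold at every point: the
   modulus forces nonnegativity and the cutoff forces the support. *)
pose F (t : R) : R[i] := if d < t < 1 - d then (normc (zext (volterra_fun f) t))%:C else 0.
have lF : cintegrable mu setT F.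
  apply: (@cintegrable_le _ T R mu setT F (zext (volterra_fun f))) => //.
  - apply: (@cmeasurable_ifT _ T R (fun t : R => d < t < 1 - d)).
    + by apply: measurable_and; apply: measurable_fun_ltr.
    + have mf := measurable_normc (iffLR (cmeasurable_zext _) (L1funP (repr f)).1).
      by split => //; exact: measurable_cst.
    + exact: (@cmeasurable_cst _ T).
  - move=> t _; rewrite /F; case: ifP => _; last by rewrite Normc.normc0 normc_ge0.
    by rewrite -lecR -!normC_normc ger0_norm// lecR normc_ge0.
  - by apply/cintegrable_zext; exact: L1funP.
have lFI : cintegrable mu I01 F by exact: cintegrable_zextT.
pose f' := MkL1fun (introT (L1_predP _) lFI).
have {f_ge0 fe0 fe1} ff' : f = volterra_class f'.
  rewrite -[LHS]volterra_funK; apply/volterra_eqP.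
  apply: filterS3 f_ge0 fe0 fe1 => t f_ge0 fe0 fe1 It.
  have := It; rewrite /= in_itv/= => /andP[t0 t1].
  rewrite /F; case: ifPn => [_|].
    by rewrite zextI ?t0// -normC_normc ger0_norm// f_ge0.
  rewrite negb_and -!leNgt => /orP[td|td].
    by apply: fe0 => //; rewrite sub0r normrN ger0_norm// (le_lt_trans td).
  by apply: fe1 => //; rewrite ger0_norm ?subr_ge0//; lra.
have F_ge0 t : 0 <= F t.
  by rewrite /F; case: ifP => // _; rewrite lecR normc_ge0.
pose g := MkL1fun (introT (L1_predP _) (cintegrable_box (ltW d_gt0))).
move=> _ [w w1 <-]; pose u t : R[i] := if t <= d then 1 else w.
have um : @cmeasurable_fun _ T R I01 u by exact: cmeasurable_ifle.
have u1 t : I01 t -> normc (u t) <= 1.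
  by move=> _; rewrite -lecR -normC_normc /u; case: ifP; rewrite ?normr1.
pose phiL := GRing.isLinear.Build _ _ _ _ _ (volterra_pairing_linear _ um u1).
pose phi : {linear volterra R -> R[i]^o} := HB.pack (volterra_pairing u) phiL.
have g1 : `|volterra_class g| = 1.
  rewrite [LHS]vnormE -cintegral_ge0 ?cintegral_box//.
  by move=> t _; exact/box_ge0/ltW.
have phig : phi (volterra_class g) = 1.
  rewrite [LHS]volterra_pairing_class//= -[RHS](cintegral_box d01).
  apply: (@eq_cintegral _ T) => t _; rewrite /box /u.
  by case: ifP; rewrite ?mulr1 ?mul0r.
exists (volterra_class g) => //; exists phi.
  apply: norming_functionalI => // h; exact: volterra_pairing_le.
rewrite ff' [alg_mul _ _]vmulE [LHS]volterra_pairing_class//=.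
rewrite cintegral_vconv_box//; last first.
  by move=> t td; rewrite /F (negbTE td).
(* Since [F] is nonnegative, its integral is the norm of [f]. *)
by congr (_ * _); rewrite cintegral_ge0 ?[RHS]vnormE.
Qed.

End unit_interval.

Theorem lemma2p12 (R : realType) (f : volterra R) (f_ge0 : volterra_ge0 f)
    (f_supp0 : ~ essential_support f 0) (f_supp1 : ~ essential_support f 1) :
  numerical_range f = [set `|f| * z | z in @closed_unit_disc R] /\
  convex_set (numerical_range f : set (Rcomplex R)).
Proof.
suff e : numerical_range f = [set `|f| * z | z in @closed_unit_disc R].
  by split => //; rewrite e; exact: convex_disc.
apply/seteqP; split; first exact: numerical_range_sub_disc.
exact: disc_sub_numerical_range.
Qed.
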